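(* Let $\alpha$ be a real number with $\tan(\alpha)=\frac{1}{\sqrt{2}}$. Then $$Cl_{2}(6\alpha-\pi)+Cl_{2}(\pi+2\alpha)-2Cl_{2}(2\alpha)+2Cl_{2}(\pi-4\alpha)=0.$$
   Context: $Cl_2$ denotes the Clausen function on $\mathbb{R}$: $Cl_{2}(x)=-\int_{0}^{x}\log\left(2\left|\sin\frac{\varphi}{2}\right|\right)d\varphi=\sum_{n=1}^{\infty}\frac{\sin(nx)}{n^{2}}$. *)

(* Defs.v *)
From HB Require Import structures.
From mathcomp Require Import all_boot all_order all_algebra.
From mathcomp Require Import all_classical all_reals all_analysis.

Set Implicit Arguments.
Unset Strict Implicit.
Unset Printing Implicit Defensive.

Import Order.TTheory GRing.Theory Num.Theory.
Import numFieldNormedType.Exports.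
Local Open Scope classical_set_scope.
Local Open Scope ring_scope.

(* The oriented integral \int_0^x f, i.e. - \int_x^0 f when x < 0. It is a
   Lebesgue integral, so that the logarithmic singularities in Cl2 below are
   integrable. *)
Definition integral_from0 (R : realType) (f : R -> R) (x : R) : R :=
  if 0 <= x then \int[@lebesgue_measure R]_(t in `[0, x]) f t
  else - \int[@lebesgue_measure R]_(t in `[x, 0]) f t.

(* At the singularities t \in 2 pi Z the integrand takes the value ln 0 = 0;
   this is a null set. *)
Definition Cl2 (R : realType) (x : R) : R :=
  - integral_from0 (fun t => ln (2 * `|sin (t / 2)|)) x.

(* Main.v *)
Require Import Defs.
From mathcomp Require Import all_boot all_order all_algebra.
From mathcomp Require Import all_classical all_reals all_analysis.
From mathcomp Require Import measurable_realfun ring lra.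
Import Order.TTheory GRing.Theory Num.Theory.
Import numFieldNormedType.Exports.
Local Open Scope classical_set_scope.
Local Open Scope ring_scope.

(* The identity is the distribution relation D(w^2) = 2 D(w) + 2 D(-w) of the
   Bloch-Wigner dilogarithm at w = 1 + i sqrt 2, each D(z) being written as
   half the sum of Cl2 at twice the angles of the triangle (0, 1, z). Along
   w = 1 + i t the relation reads as an identity between values of Cl2 at
   combinations of atan t and atan (t / 2). It is trivial at t = 0, and its
   t-derivative vanishes because the sines involved are monomials in 2, t,
   cos (atan t) and cos (atan (t / 2)). Oddness, periodicity and the
   duplication formula of Cl2 then give the statement at t = sqrt 2. *)

(** * Integrability of the log-sine integrand on bounded intervals *)

(** Monotone convergence along the intervals [[a + 1/(n+1), b - 1/(n+1)]]: on each, the fundamental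
    theorem of calculus gives a difference of two values of [G], at most [2 * C]. This handles a [g]
    that is unbounded at an endpoint. *)
Lemma ge0_integrable_bounded_antiderivative (R : realType) (a b C : R)
    (g G : R -> R) :
  a < b -> measurable_fun [set: R] g -> {in `]a, b[, forall t, 0 <= g t} ->
  {in `]a, b[, continuous g} ->
  {in `]a, b[, forall t, is_derive t (1 : R) G (g t)} ->
  {in `]a, b[, forall t, `|G t| <= C} ->
  (@lebesgue_measure R).-integrable `[a, b] (EFin \o g).
Proof.
move=> ab mg g0 cg dG GC.
have mgS (D : set R) : measurable_fun D (EFin \o g).
  by apply: measurable_funS (@subsetT _ D) _ => //; exact/measurable_EFinP.
apply/integrableP; split; first exact: mgS.
rewrite integral_itv_bndoo; last by apply: measurableT_comp.
have -> : (\int[@lebesgue_measure R]_(x in `]a, b[) `|(EFin \o g) x|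
    = \int[@lebesgue_measure R]_(x in `]a, b[) (EFin \o g) x)%E.
  apply: eq_integral => x; rewrite inE /= => xab.
  by rewrite ger0_norm ?g0.
pose A (n : nat) : set R := `[a + n.+1%:R^-1, b - n.+1%:R^-1]%classic.
have Asub n x : A n x -> x \in `]a, b[%R.
  rewrite /A /= !in_itv /= => /andP[h1 h2].
  have n0 : (0 : R) < n.+1%:R^-1 by rewrite invr_gt0 ltr0n.
  by move: (n.+1%:R^-1 : R) n0 h1 h2 => e *; apply/andP; split; lra.
have UA : \bigcup_n A n = `]a, b[%classic.
  apply/seteqP; split => [x [n _]|x]; first exact: Asub.
  rewrite /= in_itv /= => /andP[ax xb].
  have e0 : 0 < Num.min (x - a) (b - x) by rewrite lt_min !subr_gt0 ax xb.
  have [N _ /(_ N (leqnn N))] := near_infty_natSinv_lt (PosNum e0).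
  rewrite /= lt_min => /andP[h1 h2].
  exists N => //; rewrite /A /= in_itv /=.
  by move: (N.+1%:R^-1 : R) h1 h2 => e *; apply/andP; split; lra.
have ndA : nondecreasing_seq A.
  move=> m n mn; apply/subsetPset => x; rewrite /A /= !in_itv /= => /andP[h1 h2].
  have : (n.+1%:R^-1 : R) <= m.+1%:R^-1.
    by rewrite lef_pV2 ?posrE ?ltr0n// ler_nat.
  move: (n.+1%:R^-1 : R) (m.+1%:R^-1 : R) h1 h2 => e1 e2 *.
  by apply/andP; split; lra.
have A0 n x : A n x -> (0 <= (EFin \o g) x)%E.
  by move=> /Asub xab /=; rewrite lee_fin g0.
have cvgA : (\int[@lebesgue_measure R]_(x in A i) (EFin \o g) x)%E
    @[i --> \oo] -->
    (\int[@lebesgue_measure R]_(x in \bigcup_i A i) (EFin \o g) x)%E.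
  apply: ge0_nondecreasing_set_cvg_integral => //.
  - by move=> i; exact: measurable_itv.
  - by move=> i; exact: mgS.
rewrite -UA -(cvg_lim _ cvgA)//.
apply: (@le_lt_trans _ _ (2 * C)%:E); last exact: ltry.
apply: lime_le; first by apply/cvg_ex; eexists; exact: cvgA.
(* [A n] is a nondegenerate interval only once [1/(n+1) < (b - a) / 2]; an eventual bound is enough
   for the limit. *)
have e0 : 0 < (b - a) / 2 by lra.
have [N _ NP] := near_infty_natSinv_lt (PosNum e0).
exists N => // n /NP /= hn.
have n0 : (0 : R) < n.+1%:R^-1 by rewrite invr_gt0 ltr0n.
have anb : a + n.+1%:R^-1 < b - n.+1%:R^-1.
  by move: (n.+1%:R^-1 : R) hn => e *; lra.
have inab x : x \in `[a + n.+1%:R^-1, b - n.+1%:R^-1]%R -> x \in `]a, b[%R.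
  exact: Asub.
have cG x : x \in `]a, b[%R -> {for x, continuous G}.
  move=> /dG dGx; apply/differentiable_continuous/derivable1_diffP.
  exact: ex_derive.
rewrite /A (@continuous_FTC2 R g G)//.
- rewrite -EFinB lee_fin.
  have := GC _ (inab (a + n.+1%:R^-1) _); have := GC _ (inab (b - n.+1%:R^-1) _).
  rewrite !in_itv /= !lexx (ltW anb) => /(_ isT) + /(_ isT).
  by rewrite !ler_norml => /andP[? ?] /andP[? ?]; lra.
- by apply: continuous_in_subspaceT => x; rewrite inE /= => /inab; exact: cg.
- split.
  + by move=> x /subset_itv_oo_cc /inab /dG dGx; exact: ex_derive.
  + by apply/cvg_at_right_filter/cG/inab; rewrite in_itv /= lexx ltW.
  + by apply/cvg_at_left_filter/cG/inab; rewrite in_itv /= lexx ltW.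
- move=> x /subset_itv_oo_cc /inab /dG dGx.
  by rewrite derive1E derive_val.
Qed.

(** Since [sin x - x * cos x] has derivative [x * sin x >= 0], one has [s * cos s <= sin s].
    Squaring gives [s^2 <= (1 + s^2) * sin^2 s], and [s < 2] yields [1 + s^2 < 5 < 9], whence the
    crude constant 3. *)
Lemma div3_le_sin (R : realType) (s : R) :
  0 <= s <= pi / 2 -> s / 3 <= sin s.
Proof.
move=> /andP[s0 spi]; have pi2 := pihalf_lt2 R; have pi0 := pi_gt0 R.
have s_ge0 : 0 <= sin s by apply: sin_ge0_pi; rewrite s0 /=; lra.
have ge_cos : s * cos s <= sin s.
  have dh (x : R) : is_derive x (1 : R) (fun x => sin x - x * cos x) (x * sin x).
    by apply: is_derive_eq; rewrite /GRing.scale /=; ring.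
  have ch : {within `[0, s], continuous (fun x : R => sin x - x * cos x)}.
    apply: continuous_subspaceT => y.
    by apply/differentiable_continuous/derivable1_diffP; exact: ex_derive.
  have [c] := MVT_segment s0 (fun x _ => dh x) ch.
  rewrite in_itv /= => /andP[c0 cs].
  rewrite mul0r sin0 !subr0 => h; rewrite -subr_ge0 h !mulr_ge0//.
  by apply: sin_ge0_pi; rewrite c0 /=; lra.
have c_ge0 : 0 <= cos s by apply: cos_ge0_pihalf; apply/andP; split; lra.
have := cos2Dsin2 s; move: (sin s) (cos s) s_ge0 c_ge0 ge_cos => u v u0 v0 uv uv1.
rewrite leNgt; apply/negP => us.
have : (s * v) ^+ 2 <= u ^+ 2 by rewrite ler_sqr ?nnegrE ?mulr_ge0.
have : s ^+ 2 <= 2 ^+ 2 by rewrite ler_sqr ?nnegrE //; lra.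
have : (3 * u) ^+ 2 < s ^+ 2 by rewrite ltr_sqr ?nnegrE ?mulr_ge0 //; lra.
rewrite !exprMn; have -> : v ^+ 2 = 1 - u ^+ 2 by rewrite -uv1 addrK.
have := sqr_ge0 u.
move: (s ^+ 2) (u ^+ 2) => S U; nra.
Qed.

Lemma continuous_abs_sin_half (R : realType) :
  continuous (fun t : R => 2 * `|sin (t / 2)|).
Proof.
move=> x; apply: cvgM; first exact: cvg_cst.
apply: (@continuous_comp _ _ _ (fun t : R => sin (t / 2)) Num.norm); last first.
  exact: norm_continuous.
apply: (@continuous_comp _ _ _ (fun t : R => t / 2) sin); last exact: continuous_sin.
by apply: cvgM => //; exact: cvg_cst.
Qed.

Lemma measurable_log_sin (R : realType) :
  measurable_fun [set: R] (fun t : R => ln (2 * `|sin (t / 2)|)).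
Proof.
apply: (@measurableT_comp _ _ _ _ _ _ (@ln R)); first exact: measurable_ln.
exact: (continuous_measurable_fun (@continuous_abs_sin_half R)).
Qed.

(* Near a zero [c] of the sine the integrand is dominated by
   [- ln (s / 24)] with [s] the distance to [c]. *)
Lemma integrable_log_sin_half_period (R : realType) (a b c sg : R) :
  a < b -> `|sg| = 1 -> (forall s, `|sin ((c + s) / 2)| = `|sin (s / 2)|) ->
  {in `[a, b], forall t, 0 <= sg * (t - c) <= pi} ->
  {in `]a, b[, forall t, 0 < sg * (t - c)} ->
  (@lebesgue_measure R).-integrable `[a, b]
    (EFin \o (fun t => ln (2 * `|sin (t / 2)|))).
Proof.
move=> ab sg1 sinc tab tab0; have pi2 := pihalf_lt2 R.
have sgsg : sg * sg = 1.
  by rewrite -expr2 -[LHS]real_normK ?num_real// sg1 expr1n.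
(* The 24 is only large enough: for [w = sg * (t - c)] in []0, pi]] it gives [w / 24 < 1],
   [w / 24 <= w / 3 <= 2 * sin (w / 2)] and [2 <= 24 / w], which bound the logarithm from both
   sides. *)
pose u t := sg * (t - c) / 24.
have du t : is_derive t (1 : R) u (sg / 24).
  by apply: is_derive_eq; rewrite /GRing.scale /=; ring.
have cu : continuous u.
  by move=> x; apply/differentiable_continuous/derivable1_diffP; exact: ex_derive.
have u01 t : t \in `]a, b[%R -> 0 < u t < 1.
  move=> tin; rewrite /u; have := tab0 _ tin.
  have /andP[] := tab _ (subset_itv_oo_cc tin).
  by move: (sg * (t - c)) => w *; apply/andP; split; lra.
apply: (@le_integrable _ _ R (@lebesgue_measure R) _ _ _
  (EFin \o (fun t => - ln (u t)) : R -> \bar R)) => //.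
- have mf (D : set R) :
      measurable_fun D (EFin \o (fun t : R => ln (2 * `|sin (t / 2)|))).
    apply: measurable_funS (@subsetT _ D) _ => //.
    apply/measurable_EFinP.
    exact: measurable_log_sin.
  exact: mf.
- move=> t /= tin; rewrite lee_fin.
  have := tab _ tin; set w := sg * (t - c) => /andP[w0 wpi].
  have -> : `|sin (t / 2)| = `|sin (w / 2)|.
    have -> : t = c + sg * w by rewrite /w mulrA sgsg; ring.
    rewrite sinc; have /orP[] : (sg == 1) || (sg == -1).
      by rewrite -eqr_norm2 sg1 normr1.
      by move=> /eqP ->; rewrite mul1r.
    by move=> /eqP ->; rewrite mulN1r mulNr sinN normrN.
  (* At the singularity itself the integrand is [ln 0 = 0], so the domination is trivial there. *)
  have [w00|wn0] := eqVneq w 0.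
    by rewrite w00 mul0r sin0 normr0 mulr0 ln0// normr0.
  have {w0 wn0}w0 : 0 < w by rewrite lt_neqAle eq_sym wn0.
  have wsin : w / 2 / 3 <= sin (w / 2) by apply: div3_le_sin; lra.
  have sin1 := sin_le1 (w / 2).
  have s0 : 0 < sin (w / 2) by lra.
  rewrite (gtr0_norm s0) normrN /u -/w.
  rewrite (@ler0_norm _ (ln (w / 24))); last by apply: ln_le0; lra.
  have pw : (w / 24) \is Num.pos by rewrite posrE; lra.
  rewrite ler_norml opprK; apply/andP; split.
    by rewrite ler_ln ?posrE; lra.
  rewrite -lnV //.
  have pv : (w / 24)^-1 \is Num.pos by rewrite posrE invr_gt0.
  rewrite ler_ln ?posrE//; last lra.
  apply: (@le_trans _ _ 2); first lra.
  by rewrite -[leLHS]invrK lef_pV2 ?posrE ?invr_gt0//; lra.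
- pose g (t : R) := - ln (u t).
  (* This is the antiderivative [u - u * ln u] of [- ln u], rescaled for the slope [sg / 24] of [u].
     For [0 < u < 1], [- u * ln u = u * ln (1 / u) <= 1], so [u - u * ln u] lies in [[0, 2]] and [G]
     is bounded by 48. *)
  pose G (t : R) := 24 * sg * (u t - u t * ln (u t)).
  suff : (@lebesgue_measure R).-integrable `[a, b] (EFin \o g) by [].
  apply: (@ge0_integrable_bounded_antiderivative R a b 48 g G ab).
  + rewrite /g; apply: measurableT_comp => //.
    apply: (@measurableT_comp _ _ _ _ _ _ (@ln R)); first exact: measurable_ln.
    exact: (continuous_measurable_fun cu).
  + by move=> t /u01 /andP[u0 u1]; rewrite oppr_ge0 ln_le0// ltW.
  + move=> t /u01 /andP[u0 u1]; apply: cvgN.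
    by apply: (@continuous_comp _ _ _ u (@ln R)); [exact: cu|exact: continuous_ln].
  + move=> t /u01 /andP[u0 u1].
    have dln : is_derive (u t) (1 : R) (@ln R) (u t)^-1 by exact: is_derive1_ln.
    have dlnu := @is_derive1_comp R (@ln R) u t _ _ dln (du t).
    apply: is_derive_eq; rewrite /GRing.scale /= /g.
    move: (u t) (ln (u t)) u0 => v l v0.
    transitivity (sg * sg * - l); last by rewrite sgsg mul1r.
    by field; rewrite gt_eqF.
  + move=> t /u01 /andP[u0 u1].
    rewrite !normrM sg1 mulr1 normr_nat.
    have l0 : ln (u t) <= 0 by rewrite ln_le0// ltW.
    have ul : - (u t * ln (u t)) <= 1.
      rewrite -mulrN -lnV ?posrE//.
      have := ln_sublinear (x := (u t)^-1); rewrite invr_gt0 => /(_ u0) /ltW.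
      by move=> /(ler_wpM2l (ltW u0)); rewrite divff ?gt_eqF.
    have := mulr_ge0_le0 (ltW u0) l0.
    by move: (u t * ln (u t)) ul => v v1 v0; rewrite ger0_norm; lra.
Qed.

Lemma integrable_itv_cat (R : realType) (a b c : R) (f : R -> R) :
  measurable_fun [set: R] f -> a <= b -> b <= c ->
  (@lebesgue_measure R).-integrable `[a, b] (EFin \o f) ->
  (@lebesgue_measure R).-integrable `[b, c] (EFin \o f) ->
  (@lebesgue_measure R).-integrable `[a, c] (EFin \o f).
Proof.
move=> mf ab bc /integrableP[_ iab] /integrableP[_ ibc].
have mfS (D : set R) : measurable_fun D (EFin \o f).
  by apply: measurable_funS (@subsetT _ D) _ => //; exact/measurable_EFinP.
have mnf (D : set R) : measurable_fun D (fun t => `|f t|%:E).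
  have : measurable_fun D (fun t => `|(EFin \o f) t|%E) by apply: measurableT_comp.
  by [].
apply/integrableP; split; first exact: mfS.
rewrite (@itv_bndbnd_setU _ _ _ (BLeft b)) ?bnd_simp//.
rewrite ge0_integral_setU//=.
- rewrite lte_add_pinfty//.
  apply: le_lt_trans iab; apply: ge0_subset_integral => //=; first exact: mnf.
  by apply: subset_itvl; rewrite bnd_simp.
- exact: mnf.
- apply/disj_setPS => y [/=]; rewrite 2!in_itv/= => /andP[_ yb] /andP[].
  by rewrite leNgt yb.
Qed.

Lemma abs_sin_half_shift (R : realType) (n : nat) (s : R) :
  `|sin ((2 * pi * n%:R + s) / 2)| = `|sin (s / 2)|
  /\ `|sin ((- (2 * pi * n%:R) + s) / 2)| = `|sin (s / 2)|.
Proof.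
have shift (x : R) : `|sin (x + pi *+ n)| = `|sin x|.
  by rewrite (alternatingn (@sinDpi R)) normrM normrX normrN1 expr1n mul1r.
split.
  by rewrite -[RHS]shift; congr (`|sin _|); rewrite -mulr_natr; field.
by rewrite -[LHS]shift; congr (`|sin _|); rewrite -mulr_natr; field.
Qed.

(** The singularity [c] is the midpoint, hence an endpoint of each half; the sign [sg] is -1 on the
    left half and 1 on the right one. *)
Lemma integrable_log_sin_period (R : realType) (a b c : R) :
  a = c - pi -> b = c + pi -> (forall s, `|sin ((c + s) / 2)| = `|sin (s / 2)|) ->
  (@lebesgue_measure R).-integrable `[a, b]
    (EFin \o (fun t => ln (2 * `|sin (t / 2)|))).
Proof.
move=> -> -> cs; have pi0 := pi_gt0 R.
apply: (@integrable_itv_cat _ _ c); try lra.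
- exact: measurable_log_sin.
- apply: (@integrable_log_sin_half_period _ _ _ c (-1)) => //; first lra.
  + by rewrite normrN1.
  + by move=> t; rewrite in_itv /= => /andP[? ?]; apply/andP; split; lra.
  + by move=> t; rewrite in_itv /= => /andP[? ?]; lra.
- apply: (@integrable_log_sin_half_period _ _ _ c 1) => //; first lra.
  + by rewrite normr1.
  + by move=> t; rewrite in_itv /= => /andP[? ?]; apply/andP; split; lra.
  + by move=> t; rewrite in_itv /= => /andP[? ?]; lra.
Qed.

Lemma integrable_log_sin (R : realType) (a b : R) :
  (@lebesgue_measure R).-integrable `[a, b]
    (EFin \o (fun t => ln (2 * `|sin (t / 2)|))).
Proof.
have pi2 := pi_ge2 R.
(* This interval is the union of the [2n + 1] periods centred at the singularities [2 * pi * k],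
   [|k| <= n]; the induction attaches one period at each end. *)
have big n : (@lebesgue_measure R).-integrable
    `[- (2 * pi * n%:R + pi), 2 * pi * n%:R + pi]
    (EFin \o (fun t => ln (2 * `|sin (t / 2)|))).
  elim: n => [|n IH].
    rewrite mulr0 add0r.
    by apply: (@integrable_log_sin_period _ _ _ 0) => [||s]; rewrite add0r.
  have n0 : (0 : R) <= n%:R by rewrite ler0n.
  have p0 : 0 <= pi * n%:R :> R by rewrite mulr_ge0//; lra.
  have e : 2 * pi * n.+1%:R = 2 * pi * n%:R + 2 * pi :> R.
    by rewrite -natr1; ring.
  apply: (@integrable_itv_cat _ _ (2 * pi * n%:R + pi)); try lra.
  + exact: measurable_log_sin.
  + apply: (@integrable_itv_cat _ _ (- (2 * pi * n%:R + pi))); try lra.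
    * exact: measurable_log_sin.
    * apply: integrable_log_sin_period (fun s => (abs_sin_half_shift R n.+1 s).2).
        by rewrite e; ring.
      by rewrite e; ring.
    * exact: IH.
  + apply: integrable_log_sin_period (fun s => (abs_sin_half_shift R n.+1 s).1).
      by rewrite e; ring.
    by rewrite e; ring.
pose n := Num.bound (`|a| + `|b|).
have nP : `|a| + `|b| < n%:R by apply: archi_boundP; rewrite addr_ge0.
apply: integrableS (big n) => //.
move=> t /=; rewrite !in_itv /=.
have n0 : (0 : R) <= n%:R by rewrite ler0n.
have npi : 2 * n%:R <= pi * n%:R :> R by rewrite ler_wpM2r.
move: nP; have := ler_norm b; have := ler_norm (- a); rewrite normrN.
have := normr_ge0 a; have := normr_ge0 b.
by move=> ? ? ? ? ? /andP[? ?]; apply/andP; split; lra.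
Qed.

(** * Continuity and derivative of [Cl2] *)

(** Moving the base point from 0 to a fixed [- a] on the left removes the case distinction on the
    sign of [x], so that theorems on integrals with a variable upper bound apply. *)
Lemma Cl2_primitive (R : realType) (a x : R) :
  0 <= a -> - a <= x ->
  Cl2 x = \int[@lebesgue_measure R]_(t in `[- a, 0]) ln (2 * `|sin (t / 2)|)
        - \int[@lebesgue_measure R]_(t in `[- a, x]) ln (2 * `|sin (t / 2)|).
Proof.
move=> a0 ax.
pose f (t : R) := ln (2 * `|sin (t / 2)|).
have split_int u v : - a <= u -> u <= v ->
    \int[@lebesgue_measure R]_(t in `[- a, v]) f t
    - \int[@lebesgue_measure R]_(t in `[- a, u]) f t
    = \int[@lebesgue_measure R]_(t in `[u, v]) f t.
  move=> au uv; rewrite Rintegral_itvB ?bnd_simp//; last exact: integrable_log_sin.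
  rewrite Rintegral_itv_obnd_cbnd//.
  apply: (integrableS _ _ _ (integrable_log_sin R u v)) => //.
  by apply: subset_itvr; rewrite bnd_simp.
rewrite /Cl2 /integral_from0; case: ifPn => [x0|].
  by rewrite -(split_int 0 x)// ?oppr_le0// opprB.
by rewrite -ltNge => /ltW x0; rewrite opprK -(split_int x 0).
Qed.

Lemma continuous_Cl2 (R : realType) : continuous (@Cl2 R).
Proof.
move=> x; pose a := `|x| + 1.
have a0 : 0 <= a by rewrite /a addr_ge0.
have xa : - a < x < a by rewrite -ltr_norml /a ltrDl.
have aa : - a < a by case/andP: xa; exact: lt_trans.
have := parameterized_integral_continuous (ltW aa) (integrable_log_sin R (- a) a).
move=> /(continuous_within_itvP _ aa)[/(_ x) + _ _].
rewrite in_itv /= => /(_ xa) cP.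
rewrite /continuous_at (@Cl2_primitive _ a)//; last by rewrite ltW//; case/andP: xa.
apply: cvg_trans (cvgB (cvg_cst _) cP).
apply: near_eq_cvg; near=> y; apply/esym/Cl2_primitive => //.
by apply: ltW; near: y; apply: lt_nbhsr; case/andP: xa.
Unshelve. all: by end_near. Qed.

Lemma is_derive_Cl2 (R : realType) (x : R) :
  sin (x / 2) != 0 -> is_derive x (1 : R) (@Cl2 R) (- ln (2 * `|sin (x / 2)|)).
Proof.
move=> sx; pose a := `|x| + 1.
have a0 : 0 <= a by rewrite /a addr_ge0.
have /andP[ax xa] : - a < x < a.
  by rewrite -ltr_norml /a ltrDl.
pose f (t : R) := ln (2 * `|sin (t / 2)|).
have cf : {for x, continuous f}.
  apply: (@continuous_comp _ _ _ (fun t : R => 2 * `|sin (t / 2)|) (@ln R)).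
    exact: continuous_abs_sin_half.
  by apply: continuous_ln; rewrite mulr_gt0// normr_gt0.
have [dP dPf] := continuous_FTC1_closed xa (integrable_log_sin R (- a) a) ax cf.
apply: (@near_eq_is_derive _ _ _ (fun y =>
  \int[@lebesgue_measure R]_(t in `[- a, 0]) f t
  - \int[@lebesgue_measure R]_(t in `[- a, y]) f t)).
  near=> y; rewrite (@Cl2_primitive _ a)//.
  by apply: ltW; near: y; exact: lt_nbhsr.
have dP' : is_derive x (1 : R)
    (fun y => \int[@lebesgue_measure R]_(t in `[- a, y]) f t) (f x).
  by split => //; rewrite -derive1E.
rewrite -[- ln _]sub0r; exact: (is_deriveB (is_derive_cst _ _ _) dP').
Unshelve. all: by end_near. Qed.

Lemma is_derive_Cl2_comp (R : realType) (u : R -> R) (x du : R) :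
  sin (u x / 2) != 0 -> is_derive x (1 : R) u du ->
  is_derive x (1 : R) (fun y => Cl2 (u y)) (- ln (2 * `|sin (u x / 2)|) * du).
Proof.
move=> su dux.
exact: (@is_derive1_comp R (@Cl2 R) u x _ _ (is_derive_Cl2 R _ su) dux).
Qed.

Lemma continuous_Cl2_comp (R : realType) (u : R -> R) (x : R) :
  {for x, continuous u} -> {for x, continuous (fun y => Cl2 (u y))}.
Proof.
move=> cu; apply: (@continuous_comp _ _ _ u (@Cl2 R)) => //.
exact: continuous_Cl2.
Qed.

(** * Functional equations of [Cl2]: oddness, duplication, periodicity *)

Lemma is_derive0_itv_cst (R : realType) (g : R -> R) (a b : R) :
  a <= b -> {within `[a, b], continuous g} ->
  {in `]a, b[, forall t, is_derive t (1 : R) g 0} -> g a = g b.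
Proof.
move=> ab cg dg; have [c _] := MVT_segment ab dg cg.
by rewrite mul0r => /eqP; rewrite subr_eq0 => /eqP.
Qed.

(** [g] is constant between consecutive multiples of [pi], and continuity matches the constants; the
    induction proceeds outwards from 0. The three functional equations are all obtained in this
    way. *)
Lemma is_derive0_off_zeros_sin (R : realType) (g : R -> R) (x : R) :
  continuous g -> (forall t, sin t != 0 -> is_derive t (1 : R) g 0) ->
  g x = g 0.
Proof.
move=> cg dg; have pi2 := pi_ge2 R.
have sin_neq0 n t : pi * n%:R < t < pi * n.+1%:R -> sin t != 0 :> R.
  rewrite -natr1 => /andP[t1 t2].
  have -> : t = (t - pi * n%:R) + pi *+ n by rewrite -mulr_natr; ring.
  rewrite (alternatingn (@sinDpi R)) mulf_neq0// ?signr_eq0// gt_eqF//.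
  by apply: sin_gt0_pi; apply/andP; split; lra.
have cgw a b : {within `[a, b], continuous g} by exact: continuous_subspaceT.
have step n t : `|t| <= pi * n%:R -> g t = g 0.
  elim: n t => [|n IH] t; first by rewrite mulr0 normr_le0 => /eqP ->.
  have n0 : (0 : R) <= n%:R by rewrite ler0n.
  have p0 : 0 <= pi * n%:R :> R by rewrite mulr_ge0//; lra.
  have [tn _|nt tn] := leP `|t| (pi * n%:R); first exact: IH.
  have [t0|t0] := leP 0 t.
    move: nt tn; rewrite ger0_norm// => nt tn.
    transitivity (g (pi * n%:R)); last by apply: IH; rewrite ger0_norm.
    apply/esym/is_derive0_itv_cst => //; first exact: ltW.
    move=> s; rewrite in_itv /= => /andP[s1 s2]; apply: dg.
    by apply: (sin_neq0 n); rewrite s1 (lt_le_trans s2).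
  move: nt tn; rewrite ltr0_norm// => nt tn.
  transitivity (g (- (pi * n%:R))); last by apply: IH; rewrite normrN ger0_norm.
  apply/is_derive0_itv_cst => //; first by rewrite lerNr ltW.
  move=> s; rewrite in_itv /= => /andP[s1 s2]; apply: dg.
  rewrite -[s]opprK sinN oppr_eq0; apply: (sin_neq0 n).
  by apply/andP; split; lra.
pose n := Num.bound `|x|.
apply: (step n); have xn : `|x| < n%:R by exact: archi_boundP.
have n0 : (0 : R) <= n%:R by rewrite ler0n.
have : 2 * n%:R <= pi * n%:R :> R by rewrite ler_wpM2r.
by lra.
Qed.

Lemma continuous_Cl2_affine (R : realType) (a b : R) :
  continuous (fun y : R => Cl2 (a * y + b)).
Proof.
move=> x; apply: (@continuous_Cl2_comp R (fun y => a * y + b)).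
by apply: cvgD; [apply: cvgM => //|]; exact: cvg_cst.
Qed.

Lemma is_derive_Cl2_affine (R : realType) (a b x : R) :
  sin ((a * x + b) / 2) != 0 ->
  is_derive x (1 : R) (fun y => Cl2 (a * y + b))
    (- ln (2 * `|sin ((a * x + b) / 2)|) * a).
Proof.
move=> sx; apply: (@is_derive_Cl2_comp R (fun y => a * y + b)) => //.
by apply: is_derive_eq; rewrite /GRing.scale /=; ring.
Qed.

Lemma Cl2_0 (R : realType) : Cl2 (0 : R) = 0.
Proof. by rewrite /Cl2 /integral_from0 lexx set_itv1 Rintegral_set1 oppr0. Qed.

Lemma Cl2N (R : realType) (x : R) : Cl2 (- x) = - Cl2 x.
Proof.
(* The variable is doubled so that the singularities fall exactly on the zeros of [sin y]; the
   summands [+ 0] fit the affine form [a * y + b]. *)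
have := @is_derive0_off_zeros_sin R
  (fun y => Cl2 (2 * y + 0) + Cl2 (- 2 * y + 0)) (x / 2).
rewrite !mulr0 !addr0 Cl2_0 addr0 mulNr mulrC divfK// => h.
apply/eqP; rewrite -addr_eq0 addrC; apply/eqP/h.
- by move=> y; apply: cvgD; exact: continuous_Cl2_affine.
- move=> t st.
  have e1 : (2 * t + 0) / 2 = t by field.
  have e2 : (- 2 * t + 0) / 2 = - t by field.
  have := @is_derive_Cl2_affine R 2 0 t; rewrite e1 => /(_ st) d1.
  have := @is_derive_Cl2_affine R (- 2) 0 t.
  rewrite e2 sinN oppr_eq0 normrN => /(_ st) d2.
  by apply: is_derive_eq (is_deriveD d1 d2) _; ring.
Qed.

(** The derivative of the left side vanishes by [2 |sin t| = (2 |sin (t/2)|) * (2 |cos (t/2)|)], and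
    the right side is the value at 0. It stays unevaluated because [Cl2 pi = 0] is itself deduced
    from this identity. *)
Lemma Cl2_double_up_to_pi (R : realType) (x : R) :
  Cl2 (2 * x) - (Cl2 x + Cl2 x + (Cl2 (x + pi) + Cl2 (x + pi)))
  = - (Cl2 pi + Cl2 pi).
Proof.
have := @is_derive0_off_zeros_sin R (fun y => Cl2 (2 * y + 0)
  - (Cl2 (1 * y + 0) + Cl2 (1 * y + 0) + (Cl2 (1 * y + pi) + Cl2 (1 * y + pi)))) x.
rewrite !mulr0 !mul1r !addr0 !add0r Cl2_0 !add0r; apply.
- move=> y; apply: cvgB; first exact: continuous_Cl2_affine.
  by apply: cvgD; apply: cvgD; exact: continuous_Cl2_affine.
- move=> t st.
  have e2 : (2 * t + 0) / 2 = t by field.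
  have e1 : (1 * t + 0) / 2 = t / 2 by field.
  have e0 : (1 * t + pi) / 2 = t / 2 + pi / 2 by field.
  have t2 : sin t = 2 * (sin (t / 2) * cos (t / 2)).
    rewrite [in LHS](_ : t = (t / 2) *+ 2); last by rewrite -mulr_natr; field.
    by rewrite sin_mulr2n -mulr_natr; ring.
  move: (st); rewrite t2 !mulf_eq0 !negb_or pnatr_eq0 /= => /andP[s0 c0].
  have := @is_derive_Cl2_affine R 2 0 t; rewrite e2 => /(_ st) d2.
  have := @is_derive_Cl2_affine R 1 0 t; rewrite e1 => /(_ s0) d1.
  have := @is_derive_Cl2_affine R 1 pi t; rewrite e0 sinDpihalf => /(_ c0) d0.
  apply: is_derive_eq (is_deriveB d2 (is_deriveD (is_deriveD d1 d1)
    (is_deriveD d0 d0))) _.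
  have -> : 2 * `|sin t| = (2 * `|sin (t / 2)|) * (2 * `|cos (t / 2)|).
    by rewrite t2 !normrM normr_nat; ring.
  by rewrite lnM ?posrE ?mulr_gt0 ?normr_gt0//; ring.
Qed.

(** At [x = - pi / 2] oddness cancels the terms at [- pi / 2] and [pi / 2], leaving
    [- Cl2 pi = - 2 * Cl2 pi]. *)
Lemma Cl2_pi (R : realType) : Cl2 (pi : R) = 0.
Proof.
have := Cl2_double_up_to_pi R (- (pi / 2)).
have -> : 2 * - (pi / 2) = - pi :> R by field.
have -> : - (pi / 2) + pi = pi / 2 :> R by field.
by rewrite !Cl2N; lra.
Qed.

Lemma Cl2_double (R : realType) (x : R) :
  Cl2 (2 * x) = 2 * Cl2 x + 2 * Cl2 (x + pi).
Proof. by have := Cl2_double_up_to_pi R x; rewrite Cl2_pi; lra. Qed.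

Lemma Cl2_2pi (R : realType) : Cl2 (2 * pi : R) = 0.
Proof.
have := Cl2_double R (- pi); rewrite mulrN addNr !Cl2N Cl2_0 Cl2_pi.
lra.
Qed.

(** Periodicity of the integrand makes the difference constant; [Cl2_2pi], the vanishing of the
    integral over a full period, makes it 0. *)
Lemma Cl2D2pi (R : realType) (x : R) : Cl2 (x + 2 * pi) = Cl2 x.
Proof.
have := @is_derive0_off_zeros_sin R
  (fun y => Cl2 (2 * y + 2 * pi) - Cl2 (2 * y + 0)) (x / 2).
rewrite !mulr0 !add0r Cl2_2pi Cl2_0 addr0 subr0 [2 * (x / 2)]mulrC divfK// => h.
apply/eqP; rewrite -subr_eq0; apply/eqP/h.
- by move=> y; apply: cvgB; exact: continuous_Cl2_affine.
- move=> t st.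
  have e1 : (2 * t + 0) / 2 = t by field.
  have e2 : (2 * t + 2 * pi) / 2 = t + pi by field.
  have := @is_derive_Cl2_affine R 2 0 t; rewrite e1 => /(_ st) d1.
  have := @is_derive_Cl2_affine R 2 (2 * pi) t.
  rewrite e2 (@sinDpi R) oppr_eq0 normrN => /(_ st) d2.
  by apply: is_derive_eq (is_deriveB d2 d1) _; ring.
Qed.

Lemma Cl2D2piz (R : realType) (x : R) (k : int) : Cl2 (x + 2 * pi * k%:~R) = Cl2 x.
Proof.
have nat_case (n : nat) y : Cl2 (y + 2 * pi * n%:R) = Cl2 y :> R.
  elim: n y => [|n IH] y; first by rewrite mulr0 addr0.
  by rewrite -[n.+1%:R]natr1 mulrDr mulr1 addrA Cl2D2pi IH.
case: k => n; first exact: nat_case.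
by rewrite NegzE rmorphN /= -[LHS](nat_case n.+1) mulrN subrK.
Qed.

(** * The distribution relation along [w = 1 + i t] *)

Lemma sin_atan (R : realType) (x : R) : sin (atan x) = x * cos (atan x).
Proof.
have c0 : cos (atan x) != 0.
  by rewrite cos_atan invr_eq0 gt_eqF// sqrtr_gt0 ltr_wpDr ?sqr_ge0.
by rewrite -{2}(atanK x) /tan divfK.
Qed.

(** Here [phi] is the argument of [w] and [psi] the angle at 1 of the triangle (0, 1, -w). The first
    three terms are [2 D(w^2)], up to oddness and periodicity in the third. Of the others,
    [- 2 Cl2 (2 phi) - 2 Cl2 (pi - 2 phi)] is [- 4 D(w)], and the rest is [- 4 D(-w)]. *)
Lemma Cl2_atan_relation (R : realType) (t : R) : 0 <= t ->
  let phi := atan t in let psi := atan (t / 2) in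
  Cl2 (4 * phi) + Cl2 (pi - 2 * psi) - Cl2 (4 * phi - 2 * psi + pi)
  - 4 * Cl2 (2 * phi) - 2 * Cl2 (pi - 2 * phi)
  + 2 * Cl2 (2 * psi) + 2 * Cl2 (2 * phi - 2 * psi) = 0.
Proof.
move=> t0.
(* All seven arguments have this shape, so continuity and differentiation are done once. *)
pose A (a b c : R) (x : R) := a * atan x + b * atan (x / 2) + c.
pose F (x : R) := Cl2 (A 4 0 0 x) + Cl2 (A 0 (- 2) pi x) - Cl2 (A 4 (- 2) pi x)
  - 4 *: Cl2 (A 2 0 0 x) - 2 *: Cl2 (A (- 2) 0 pi x)
  + 2 *: Cl2 (A 0 2 0 x) + 2 *: Cl2 (A 2 (- 2) 0 x).
have F0 : F 0 = 0.
  rewrite /F /A !mul0r atan0 !mulr0 !addr0 !add0r Cl2_0 Cl2_pi /GRing.scale /=.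
  by rewrite !mulr0; ring.
have cA a b c : continuous (A a b c).
  move=> x; apply: cvgD; last exact: cvg_cst.
  apply: cvgD; apply: cvgM; try exact: cvg_cst; first exact: continuous_atan.
  apply: (@continuous_comp _ _ _ (fun x : R => x / 2) (@atan R)).
    by apply: cvgM => //; exact: cvg_cst.
  exact: continuous_atan.
have cClA a b c : continuous (fun x => Cl2 (A a b c x)).
  by move=> x; apply: continuous_Cl2_comp; exact: cA.
have cF : continuous F.
  have cZ k a b c : continuous (fun x => k *: Cl2 (A a b c x)).
    by move=> x; apply: cvgM; [exact: cvg_cst|exact: cClA].
  move=> x; apply: cvgD; last exact: cZ; apply: cvgD; last exact: cZ.
  apply: cvgB; last exact: cZ; apply: cvgB; last exact: cZ.
  apply: cvgB; last exact: cClA; apply: cvgD; exact: cClA.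
suff F_cst : F 0 = F t.
  rewrite -F0 F_cst /F /A /GRing.scale /= !mul0r !addr0 !add0r.
  by rewrite ![_ + pi]addrC !mulNr.
apply: is_derive0_itv_cst => //; first exact: continuous_subspaceT.
move=> s; rewrite in_itv /= => /andP[s0 _].
(* From here [t] is an interior point. Its positivity makes all seven half-argument sines positive,
   which removes the absolute values. *)
move: s s0 => {}t {}t0.
pose dphi := (1 + t ^+ 2)^-1; pose dpsi := (1 + (t / 2) ^+ 2)^-1 * 2^-1.
have dA a b c : is_derive t (1 : R) (A a b c) (a * dphi + b * dpsi).
  have d2 : is_derive t (1 : R) (fun x => atan (x / 2)) dpsi.
    have d1 : is_derive t (1 : R) (fun x : R => x / 2) (2^-1).
      by apply: is_derive_eq; rewrite /GRing.scale /=; ring.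
    exact: (@is_derive1_comp R (@atan R) (fun x => x / 2)).
  have d1 : is_derive t (1 : R) (@atan R) dphi by exact: is_derive1_atan.
  by apply: is_derive_eq; rewrite /GRing.scale /=; ring.
have dClA a b c s : 0 < s -> sin (A a b c t / 2) = s ->
    is_derive t (1 : R) (fun x => Cl2 (A a b c x))
      (- (ln 2 + ln s) * (a * dphi + b * dpsi)).
  move=> s0 es; have := @is_derive_Cl2_comp R (A a b c) t _ _ (dA a b c).
  rewrite es gtr0_norm// lnM ?posrE//; apply.
  by rewrite gt_eqF.
pose C := cos (atan t); pose D := cos (atan (t / 2)).
have C0 : 0 < C by rewrite /C cos_atan invr_gt0 sqrtr_gt0 ltr_wpDr ?sqr_ge0.
have D0 : 0 < D by rewrite /D cos_atan invr_gt0 sqrtr_gt0 ltr_wpDr ?sqr_ge0.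
have sC := sin_atan R t; have sD := sin_atan R (t / 2).
have sin2 : sin (2 * atan t) = 2 * (t * (C * C)).
  by rewrite mulr_natl sin_mulr2n sC -/C -mulr_natr; ring.
have cos2 : cos (2 * atan t) = C * C * (1 - t ^+ 2).
  by rewrite mulr_natl mulr2n cosD sC -/C; ring.
have /dClA h1 : sin (A 4 0 0 t / 2) = (2 * (t * (C * C))).
  by rewrite -sin2; congr sin; rewrite /A; field.
have /dClA h2 : sin (A 0 (- 2) pi t / 2) = D.
  by rewrite /D -[RHS]cosN -sinDpihalf; congr sin; rewrite /A; field.
have /dClA h3 : sin (A 4 (- 2) pi t / 2) = (C * C * D).
  transitivity (cos (2 * atan t - atan (t / 2))).
    by rewrite -sinDpihalf; congr sin; rewrite /A; field.
  (* The sum is [C^2 * D * ((1 - t^2) + t^2)]: the [t^2] terms cancel and a monomial remains. *)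
  by rewrite cosB sin2 cos2 sD -/D; field.
have /dClA h4 : sin (A 2 0 0 t / 2) = (t * C).
  by rewrite -sC; congr sin; rewrite /A; field.
have /dClA h5 : sin (A (- 2) 0 pi t / 2) = C.
  by rewrite /C -[RHS]cosN -sinDpihalf; congr sin; rewrite /A; field.
have /dClA h6 : sin (A 0 2 0 t / 2) = (t * D / 2).
  transitivity (sin (atan (t / 2))); first by congr sin; rewrite /A; field.
  by rewrite sD -/D; field.
have /dClA h7 : sin (A 2 (- 2) 0 t / 2) = (t * (C * D) / 2).
  transitivity (sin (atan t - atan (t / 2))); first by congr sin; rewrite /A; field.
  by rewrite sinB sC sD -/C -/D; field.
have dF := is_deriveD (is_deriveD (is_deriveB (is_deriveB (is_deriveB
  (is_deriveD (h1 _) (h2 D0)) (h3 _)) (is_deriveZ 4 (h4 _))) (is_deriveZ 2 (h5 C0)))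
  (is_deriveZ 2 (h6 _))) (is_deriveZ 2 (h7 _)).
apply: is_derive_eq (dF _ _ _ _ _) _; rewrite ?mulr_gt0//.
(* Expanded, the derivative is a combination of [ln 2], [ln t], [ln C] and [ln D] whose
   coefficients, linear forms in [dphi] and [dpsi], each vanish identically. *)
rewrite /GRing.scale /= ?lnM ?lnV ?posrE ?mulr_gt0 ?invr_gt0//.
by ring.
Qed.

(** * Specialisation to [t = sqrt 2] and reduction of the angle modulo [pi] *)

Lemma tanDpiz (R : realType) (x : R) (k : int) : tan (x + pi * k%:~R) = tan x.
Proof.
have nat_case (n : nat) y : tan (y + pi * n%:R) = tan y :> R.
  elim: n y => [|n IH] y; first by rewrite mulr0 addr0.
  by rewrite -[n.+1%:R]natr1 mulrDr mulr1 addrA tanDpi IH.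
case: k => n; first exact: nat_case.
by rewrite NegzE rmorphN /= -[LHS](nat_case n.+1) mulrN subrK.
Qed.

Lemma tan_eq_atan (R : realType) (x y : R) :
  y != 0 -> tan x = y -> exists k : int, x = atan y + pi * k%:~R.
Proof.
move=> y0 xy; have pi0 := pi_gt0 R.
pose k := Num.floor ((x + pi / 2) / pi).
have [k1 k2] : pi * k%:~R <= x + pi / 2 /\ x + pi / 2 < pi * k%:~R + pi.
  have /andP[h1 h2] := floor_itv ((x + pi / 2) / pi).
  rewrite ler_pdivlMr// in h1; rewrite ltr_pdivrMr// intrD in h2.
  by split; rewrite [pi * _]mulrC; move: h1 h2; rewrite -/k; lra.
exists k; rewrite -xy -(subrK (pi * k%:~R) x) tanDpiz tanK ?subrK//.
rewrite in_itv /=; apply/andP; split; last by lra.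
(* The floor gives only the weak inequality. Equality would be a pole of the tangent, where [tan]
   has the default value 0, contrary to [y != 0]. *)
rewrite lt_neqAle; apply/andP; split; last by lra.
apply: contra y0 => /eqP e.
by rewrite -xy -(subrK (pi * k%:~R) x) tanDpiz -e tanN tan_pihalf oppr0.
Qed.

(** At [t = sqrt 2] the two angles depend on [a] alone: [t / 2 = 1 / t] gives [psi = a], and [phi],
    having the inverse tangent value, is the complement [pi / 2 - a]. *)
Lemma Cl2_atan_inv_sqrt2 (R : realType) (a : R) : a = atan (1 / Num.sqrt 2) ->
  Cl2 (6 * a - pi) + Cl2 (pi + 2 * a) - 2 * Cl2 (2 * a) + 2 * Cl2 (pi - 4 * a) = 0.
Proof.
move=> ea.
have s0 : 0 < Num.sqrt 2 :> R by rewrite sqrtr_gt0.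
have ss : Num.sqrt 2 * Num.sqrt 2 = 2 :> R by rewrite -expr2 sqr_sqrtr.
have psi : atan (Num.sqrt 2 / 2) = a.
  rewrite ea; congr atan; apply: (mulIf (lt0r_neq0 s0)).
  by rewrite mulrAC ss !divff // divfK // lt0r_neq0.
have ta : tan a = 1 / Num.sqrt 2 by rewrite ea atanK.
have a0 : 0 < a by rewrite ea -(atan0 R) lt_atan// divr_gt0.
have api : a < pi / 2 by rewrite ea atan_ltpi2.
have phi : atan (Num.sqrt 2) = pi / 2 - a.
  rewrite -[RHS]tanK; last by rewrite in_itv /=; apply/andP; split; lra.
  congr atan; rewrite /tan -[sin _]opprK -cosDpihalf.
  rewrite [pi / 2 - a + pi / 2](_ : _ = pi - a); last by field.
  rewrite [cos (pi / 2 - a)](_ : _ = sin a); last first.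
    by rewrite -cosBpihalf -[RHS]cosN; congr cos; ring.
  rewrite addrC (@cosDpi R) cosN opprK.
  by rewrite -invf_div -/(tan a) ta div1r invrK.
have := @Cl2_atan_relation R (Num.sqrt 2) (ltW s0); rewrite /= psi phi.
have -> : 4 * (pi / 2 - a) = - (4 * a) + 2 * pi by field.
have -> : - (4 * a) + 2 * pi - 2 * a + pi = pi - 6 * a + 2 * pi by ring.
have -> : 2 * (pi / 2 - a) = pi - 2 * a by field.
have -> : pi - (pi - 2 * a) = 2 * a by ring.
have -> : pi - 2 * a - 2 * a = pi - 4 * a by ring.
have -> : pi - 6 * a = - (6 * a - pi) by ring.
rewrite !Cl2D2pi.
have -> : Cl2 (pi - 2 * a) = - Cl2 (pi + 2 * a).
  by rewrite -Cl2N -[RHS]Cl2D2pi; congr Cl2; ring.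
(* The relation now contains [- Cl2 (4a) + 3 Cl2 (pi + 2a)]; duplication at [2a] turns this into
   [Cl2 (pi + 2a) - 2 Cl2 (2a)]. *)
rewrite !Cl2N [4 * a](_ : _ = 2 * (2 * a)); last by ring.
rewrite [Cl2 (2 * (2 * a))]Cl2_double [2 * a + pi]addrC.
by lra.
Qed.

Theorem mainTheorem5 (R : realType) (alpha : R)
    (halpha : tan alpha = 1 / Num.sqrt 2) :
  Cl2 (6 * alpha - pi) + Cl2 (pi + 2 * alpha) - 2 * Cl2 (2 * alpha)
    + 2 * Cl2 (pi - 4 * alpha) = 0.
Proof.
have y0 : 1 / Num.sqrt 2 != 0 :> R by rewrite mul1r invr_eq0 gt_eqF// sqrtr_gt0.
have [k ->] := tan_eq_atan R _ _ y0 halpha.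
set a := atan _; rewrite -[RHS](@Cl2_atan_inv_sqrt2 R a)//.
(* Adding [k * pi] to the angle moves the four arguments by [2 * pi] times [3k], [k], [k] and
   [-2k]. *)
have shift (x y : R) (j : int) : x = y + 2 * pi * j%:~R -> Cl2 x = Cl2 y.
  by move=> ->; exact: Cl2D2piz.
rewrite (shift (6 * (a + pi * k%:~R) - pi) (6 * a - pi) (3 * k)); last first.
  by rewrite rmorphM /=; ring.
rewrite (shift (pi + 2 * (a + pi * k%:~R)) (pi + 2 * a) k); last by ring.
rewrite (shift (2 * (a + pi * k%:~R)) (2 * a) k); last by ring.
rewrite (shift (pi - 4 * (a + pi * k%:~R)) (pi - 4 * a) (- (2 * k)))//.
by rewrite rmorphN rmorphM /=; ring.
Qed.
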